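(* Let $H$ be a target graph, possibly with loops, and let $H^1,\ldots,H^k$ be the automorphic similarity classes of $H$, with $M$ the associated automorphic similarity matrix. Denote by $\mathbf{a}(H)$ the row vector whose $i$-th entry is $|H^i|$. Let $G_0$ be a graph, fix a vertex $v_0\in V(G_0)$, and let $\{G_n\}_{n=0}^\infty$ be the path-like family with seed graph $G_0$ and fixed vertex $v_0$. Then for all $n\ge 0$, $$\hom(G_n,H)=\mathbf{a}(H)\,M^n\,\mathbf{h}(G_0,v_0).$$
   Context: All graphs are finite. For a simple loopless graph $G$ and a target graph $H$ (possibly with loops, no multi-edges), an $H$-coloring of $G$ is a map $f:V(G)\to V(H)$ such that $f(x)$ and $f(y)$ are adjacent in $H$ whenever $x$ and $y$ are adjacent in $G$ (a looped vertex is adjacent to itself); $\hom(G,H)$ denotes the number of $H$-colorings of $G$. Vertices $u,v$ of $H$ are automorphically similar if some automorphism of $H$ sends $u$ to $v$. This is an equivalence relation on $V(H)$; its classes $H^1,\dots,H^k$ (listed in a fixed order) are the automorphic similarity classes of $H$. For $1\le i,j\le k$, $m_{i,j}$ is the number of neighbors that a vertex $v\in H^i$ has in $H^j$ (a looped vertex counts as a neighbor of itself); this does not depend on the choice of $v\in H^i$. The automorphic similarity matrix of $H$ is the $k\times k$ matrix $M$ with $(i,j)$-entry $m_{i,j}$. For a graph $G$ with designated vertex $v$, $\mathbf{h}(G,v)$ is the column vector of length $k$ whose $i$-th entry is the number of $H$-colorings of $G$ in which $v$ is mapped to a given arbitrary but specific representative of $H^i$ (this number does not depend on the representative chosen). Path-like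 family: given a graph $G_0$ (simple, loopless, not necessarily a tree) and a vertex $v_0$ of $G_0$, for $n\ge 0$ the graph $G_n$ is formed from $G_0$ by appending a path with $n$ new vertices to $v_0$, i.e. adding new vertices $v_1,\dots,v_n$ and the edges $v_{i-1}v_i$ for $1\le i\le n$. $\{G_n\}_{n=0}^\infty$ is the path-like family with seed graph $G_0$ and fixed vertex $v_0$. *)

(* Defs.v *)
From HB Require Import structures.
From mathcomp Require Import all_boot all_order all_fingroup all_algebra.

Set Implicit Arguments.
Unset Strict Implicit.
Unset Printing Implicit Defensive.

(* Finite graphs without multi-edges; [adj x x] means that [x] is looped, and
   a looped vertex is then counted once among its own neighbours. *)
Record graph := Graph {
  vertex :> finType;
  adj : rel vertex;
  adj_sym : symmetric adj }.

Arguments adj {g} x y.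

Record sgraph := SGraph {
  sgraph_graph :> graph;
  adj_irr : irreflexive (@adj sgraph_graph) }.

Definition colorings (G : sgraph) (H : graph) : {set {ffun G -> H}} :=
  [set f : {ffun G -> H} |
    [forall x : G, forall y : G, adj x y ==> adj (f x) (f y)]].

Definition num_colorings (G : sgraph) (H : graph) : nat := #|colorings G H|.

Definition automorphism (H : graph) (s : {perm H}) : bool :=
  [forall x : H, forall y : H, adj (s x) (s y) == adj x y].

Definition similar (H : graph) : rel H :=
  fun u v => [exists s : {perm H}, automorphism s && (s u == v)].

Lemma similar_equiv (H : graph) :
  {in [set: H] & &, equivalence_rel (@similar H)}.
Proof.
have S u v : @similar H u v -> similar v u.
  case/existsP=> s /andP[/forallP aut /eqP <-]; apply/existsP; exists (s^-1)%g.
  rewrite permK eqxx andbT; apply/forallP=> x; apply/forallP=> y.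
  by have /forallP/(_ (s^-1 y)%g)/eqP := aut (s^-1 x)%g; rewrite !permKV => <-.
have T u v w : @similar H u v -> similar v w -> similar u w.
  case/existsP=> s /andP[/forallP auts /eqP <-].
  case/existsP=> t /andP[/forallP autt /eqP <-]; apply/existsP; exists (s * t)%g.
  rewrite permM eqxx andbT; apply/forallP=> x; apply/forallP=> y; rewrite !permM.
  have /forallP/(_ (s y))/eqP -> := autt (s x).
  by have /forallP/(_ y) := auts x.
move=> u v w _ _ _; split.
  apply/existsP; exists 1%g; rewrite perm1 eqxx andbT.
  by apply/forallP=> x; apply/forallP=> y; rewrite !perm1.
by move=> uv; apply/idP/idP; [apply: T; apply: S | apply: T].
Qed.

Definition similarity_classes (H : graph) : {set {set H}} :=
  equivalence_partition (@similar H) [set: H].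

Definition lists_classes (H : graph) (k : nat) (cls : 'I_k -> {set H}) : Prop :=
  injective cls /\ [set cls i | i : 'I_k] = similarity_classes H.

Definition representatives (H : graph) (k : nat)
  (cls : 'I_k -> {set H}) (r : 'I_k -> H) : Prop := forall i, r i \in cls i.

Section Vectors.
Variables (H : graph) (k : nat) (cls : 'I_k -> {set H}) (r : 'I_k -> H).

Definition size_row : 'rV[nat]_k := \row_i #|cls i|.

Definition similarity_matrix : 'M[nat]_k :=
  \matrix_(i, j) #|[set w in cls j | adj (r i) w]|.

Definition hom_col (G : sgraph) (v : G) : 'cV[nat]_k :=
  \col_i #|[set f in colorings G H | f v == r i]|.

End Vectors.

Section PathLike.
Variables (G0 : sgraph) (v0 : G0) (n : nat).

(* [inl x] is the vertex [x] of [G0]; [inr i] is the new vertex v_(i+1). *)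
Definition pathlike_adj : rel (G0 + 'I_n) := fun a b =>
  match a, b with
  | inl x, inl y => adj x y
  | inl x, inr i | inr i, inl x => (x == v0) && (i == 0 :> nat)
  | inr i, inr j => (i.+1 == j) || (j.+1 == i)
  end.

Lemma pathlike_adj_sym : symmetric pathlike_adj.
Proof. by case=> [x|i] [y|j] //=; [exact: adj_sym | rewrite orbC]. Qed.

Lemma pathlike_adj_irr : irreflexive pathlike_adj.
Proof. by case=> [x|i] /=; [exact: adj_irr | rewrite orbb gtn_eqF]. Qed.

Definition pathlike : sgraph :=
  @SGraph (Graph pathlike_adj_sym) pathlike_adj_irr.

End PathLike.

(* Main.v *)
(** Write A for the adjacency operator of H acting on functions V(H) -> nat.
    Colorings of G_n are pairs of a coloring of G_0 and a walk of length n in H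
    starting at the color of v_0; since A is symmetric, their number is the sum
    over V(H) of A^n h, where h(u) counts the colorings of G_0 with v_0 sent
    to u.  Automorphisms of H preserve h, and A maps functions constant on the
    similarity classes to such functions, acting on their values by M. *)
Require Import Defs.
From mathcomp Require Import all_boot all_order all_fingroup all_algebra.

Set Implicit Arguments.
Unset Strict Implicit.
Unset Printing Implicit Defensive.

Import GRing.Theory.
Local Open Scope ring_scope.

Definition num_colorings_at (G : sgraph) (v : G) (H : graph) (u : H) : nat :=
  #|[set f in colorings G H | f v == u]|.

Definition neighbor_sum (H : graph) (h : H -> nat) (u : H) : nat :=
  (\sum_(w | adj u w) h w)%N.

(** The start [u] is left out of the tuple, so the entries are exactly the colors of the [n] new
    vertices. *)
Definition num_walks (H : graph) (n : nat) (u : H) : nat :=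
  #|[set t : n.-tuple H | path adj u t]|.

Lemma num_walks0 (H : graph) (u : H) : num_walks 0 u = 1%N.
Proof.
rewrite /num_walks -[RHS](cards1 [tuple of [::] : seq H]).
by apply: eq_card => t; rewrite tuple0 !inE /=.
Qed.

(** A walk splits into its first step, to a neighbor of [u], and a shorter walk from there; [c] is
    this splitting read backwards. *)
Lemma num_walksS (H : graph) (n : nat) (u : H) :
  num_walks n.+1 u = neighbor_sum (num_walks n) u.
Proof.
rewrite /num_walks /neighbor_sum.
pose c (p : H * n.-tuple H) := [tuple of p.1 :: p.2].
have cbij : bijective c.
  exists (fun t => (thead t, [tuple of behead t])) => [[x t]|t] /=.
    by rewrite theadE; congr (_, _); apply: val_inj.
  by rewrite [RHS]tuple_eta.
rewrite -(on_card_preimset (onW_bij _ cbij)) -sum1_card.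
under [RHS]eq_bigr do rewrite -sum1_card.
by rewrite pair_big_dep; apply: eq_bigl => -[x t]; rewrite !inE.
Qed.

(** Self-adjointness of [neighbor_sum] moves it from the walk count onto [h], one step at a time.
    The induction keeps [h] general because its hypothesis is used at [neighbor_sum h]. *)
Lemma sum_mul_num_walks (H : graph) (n : nat) (h : H -> nat) :
  (\sum_u h u * num_walks n u = \sum_u iter n (@neighbor_sum H) h u)%N.
Proof.
elim: n h => [|n IHn] h.
  by apply: eq_bigr => u _; rewrite num_walks0 muln1.
rewrite iterSr -IHn.
under eq_bigr do rewrite num_walksS big_distrr /=.
(* After the exchange, [u] ranges over the vertices with an edge to [w]; symmetry of [adj] makes
   them the neighbors of [w]. *)
rewrite (exchange_big_dep predT) //=; apply: eq_bigr => w _.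
by rewrite big_distrl /=; apply: eq_bigl => u; rewrite adj_sym.
Qed.

Section PathLikeColorings.
Variables (H : graph) (G0 : sgraph) (v0 : G0) (n : nat).

(** Defined on all maps, not only on colorings, so that it is a bijection of whole types and
    cardinalities transfer by taking preimages. *)
Definition glue (p : {ffun G0 -> H} * n.-tuple H) :
    {ffun pathlike v0 n -> H} :=
  [ffun a : G0 + 'I_n =>
    match a with inl x => p.1 x | inr i => tnth p.2 i end].

Lemma glue_bij : bijective glue.
Proof.
exists (fun f : {ffun pathlike v0 n -> H} =>
  ([ffun x => f (inl x)], [tuple f (inr i) | i < n])) => [[g t]|f].
  by congr (_, _); [apply/ffunP => x | apply: eq_from_tnth => i];
    rewrite ?tnth_mktuple !ffunE.
by apply/ffunP => -[x|i]; rewrite !ffunE ?tnth_mktuple //= ffunE.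
Qed.

(** The edges outside the seed graph join consecutive vertices of v_0, v_1, ..., v_n, so the
    condition on them is that the colors form a walk from [p.1 v0]. *)
Lemma glue_coloring p :
  (glue p \in colorings (pathlike v0 n) H) =
  (p.1 \in colorings G0 H) && path adj (p.1 v0) p.2.
Proof.
case: p => g t /=; rewrite !inE; apply/idP/idP.
  move=> /forallP col.
  have {}col a b : pathlike_adj v0 a b -> adj (glue (g, t) a) (glue (g, t) b).
    by move=> ab; have /forallP/(_ b)/implyP := col a; apply.
  apply/andP; split.
    apply/forallP => x; apply/forallP => y; apply/implyP => xy.
    by have := col (inl x) (inl y) xy; rewrite !ffunE.
  apply/(pathP (g v0)) => i; rewrite size_tuple => lt_i_n.
  (* Step 0 of the walk is the edge from [v0] to the first new vertex; every later step joins two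
     new vertices. *)
  case: i lt_i_n => [|i] lt_i_n /=.
    have := col (inl v0) (inr (Ordinal lt_i_n)); rewrite !ffunE /= eqxx => /(_ isT).
    by rewrite (tnth_nth (g v0)).
  have := col (inr (Ordinal (ltnW lt_i_n))) (inr (Ordinal lt_i_n)).
  by rewrite !ffunE /= eqxx => /(_ isT); rewrite !(tnth_nth (g v0)).
case/andP=> /forallP colg /(pathP (g v0)); rewrite size_tuple => walk.
have first (i : 'I_n) : i == 0 :> nat -> adj (g v0) (tnth t i).
  by move=> /eqP i0; have := walk i (ltn_ord i); rewrite (tnth_nth (g v0)) i0.
have step (i j : 'I_n) : i.+1 == j -> adj (tnth t i) (tnth t j).
  by move=> /eqP ij; have := walk j (ltn_ord j); rewrite !(tnth_nth (g v0)) -ij.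
apply/forallP => a; apply/forallP => b; apply/implyP.
case: a b => [x|i] [y|j] /=; rewrite !ffunE /=.
- by have /forallP/(_ y)/implyP := colg x.
- by case/andP=> /eqP-> /first.
- by case/andP=> /eqP-> /first; rewrite adj_sym.
- by case/orP=> /step //; rewrite adj_sym.
Qed.

Lemma num_colorings_pathlike :
  num_colorings (pathlike v0 n) H =
    (\sum_u iter n (@neighbor_sum H) (num_colorings_at v0 (H := H)) u)%N.
Proof.
rewrite -sum_mul_num_walks /num_colorings.
rewrite -(on_card_preimset (onW_bij _ glue_bij)) -sum1_card.
transitivity (\sum_(g in colorings G0 H) num_walks n (g v0))%N.
  under [RHS]eq_bigr do rewrite /num_walks -sum1_card.
  rewrite pair_big_dep; apply: eq_bigl => p.
  by rewrite [LHS]inE glue_coloring !inE.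
(* The number of walks depends on [g] only through the color of [v0], so colorings are grouped by
   that color. *)
rewrite (partition_big (fun g : {ffun G0 -> H} => g v0) predT) //=.
apply: eq_bigr => u _.
rewrite (eq_bigr (fun=> num_walks n u)) => [|g /andP[_ /eqP->] //].
rewrite sum_nat_const; congr (_ * _)%N.
by apply: eq_card => g; rewrite [in RHS]inE.
Qed.

End PathLikeColorings.

(** Composition with an automorphism sending [u] to [w] permutes the maps into [H], preserves
    colorings both ways and turns the color [u] of [v] into [w]. *)
Lemma num_colorings_at_similar (G : sgraph) (v : G) (H : graph) (u w : H) :
  Defs.similar u w -> num_colorings_at v u = num_colorings_at v w.
Proof.
case/existsP=> s /andP[/forallP aut /eqP <-].
have {}aut x y : adj (s x) (s y) = adj x y.
  by have /forallP/(_ y)/eqP := aut x.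
pose c (f : {ffun G -> H}) := [ffun x => s (f x)].
have cbij : bijective c.
  exists (fun f : {ffun G -> H} => [ffun x => s^-1%g (f x)]) => f;
    by apply/ffunP => x; rewrite !ffunE ?permK ?permKV.
rewrite /num_colorings_at -[RHS](on_card_preimset (onW_bij _ cbij)).
apply: eq_card => f; rewrite !inE ffunE (inj_eq perm_inj); congr (_ && _).
by apply: eq_forallb => x; apply: eq_forallb => y; rewrite !ffunE aut.
Qed.

Section Classes.
Variables (H : graph) (k : nat) (cls : 'I_k -> {set H}).
Hypothesis hcls : lists_classes cls.

Lemma similar_in_class i u w : u \in cls i -> w \in cls i -> Defs.similar u w.
Proof.
move=> ui wi; have [_ img] := hcls.
have cls_i : cls i \in similarity_classes H by rewrite -img imset_f.
rewrite -(pblock_equivalence_partition (@similar_equiv H)) ?inE //.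
have /and3P[_ triv _] := equivalence_partitionP (@similar_equiv H).
by rewrite -[equivalence_partition _ _]/(similarity_classes H)
  (def_pblock triv cls_i ui).
Qed.

Lemma similar_class_trans i u w : Defs.similar u w -> u \in cls i -> w \in cls i.
Proof.
move=> uw ui; have [_ img] := hcls.
have cls_i : cls i \in similarity_classes H by rewrite -img imset_f.
have /and3P[_ triv _] := equivalence_partitionP (@similar_equiv H).
rewrite -(def_pblock triv cls_i ui).
by rewrite (pblock_equivalence_partition (@similar_equiv H)) ?inE.
Qed.

(** The classes partition the vertices, and injectivity of [cls] turns a sum over classes into one
    over indices. *)
Lemma sum_classes (F : H -> nat) :
  (\sum_u F u = \sum_i \sum_(u in cls i) F u)%N.
Proof.
have [inj img] := hcls.
have part := equivalence_partitionP (@similar_equiv H).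
rewrite -(eq_bigl _ _ (in_setT (T := H))) (set_partition_big _ part) /=.
rewrite -[equivalence_partition _ _]/(similarity_classes H) -img.
by rewrite big_imset //= => i j _ _ /inj.
Qed.

(** An automorphism sending [u] to [w] carries neighbors to neighbors and maps [cls j] onto
    itself. *)
Lemma class_degree i j u w : u \in cls i -> w \in cls i ->
  #|[set x in cls j | adj u x]| = #|[set x in cls j | adj w x]|.
Proof.
move=> ui wi; case/existsP: (similar_in_class ui wi) => s /andP[aut /eqP sw].
rewrite -[RHS](on_card_preimset (onW_bij _ (Bijective (permK s) (permKV s)))).
apply: eq_card => x; rewrite !inE -sw.
have /forallP/(_ u)/forallP/(_ x)/eqP -> := aut; congr (_ && _).
have xs : Defs.similar x (s x) by apply/existsP; exists s; rewrite aut eqxx.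
have sx : Defs.similar (s x) x.
  (* Symmetry comes from the equivalence property with third point [x], which reduces the claim to
     reflexivity. *)
  have [_ /(_ xs) <-] := similar_equiv (in_setT x) (in_setT (s x)) (in_setT x).
  by have [] := similar_equiv (in_setT x) (in_setT x) (in_setT x).
by apply/idP/idP; apply: similar_class_trans.
Qed.

(** Grouped by class, the neighbors of [u] in [cls j] all carry the value [c j ord0], and
    [class_degree] says their number is the matrix entry computed at [r i]. *)
Lemma neighbor_sum_class (r : 'I_k -> H) (h : H -> nat) (c : 'cV[nat]_k) :
    representatives cls r -> (forall i u, u \in cls i -> h u = c i ord0) ->
  forall i u, u \in cls i ->
    neighbor_sum h u = (similarity_matrix cls r *m c) i ord0.
Proof.
move=> hr hc i u ui; rewrite /neighbor_sum big_mkcond sum_classes !mxE.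
apply: eq_bigr => j _; rewrite mxE (class_degree j (hr i) ui) -big_mkcondr /=.
rewrite (eq_bigr (fun=> c j ord0)) => [|w /andP[/hc-> _] //].
rewrite sum_nat_const; congr (_ * _)%N.
by apply: eq_card => w; rewrite [in RHS]inE.
Qed.

Lemma iter_neighbor_sum_class (r : 'I_k -> H) (h : H -> nat)
    (c : 'cV[nat]_k) (n : nat) :
    representatives cls r -> (forall i u, u \in cls i -> h u = c i ord0) ->
  forall i u, u \in cls i ->
    iter n (@neighbor_sum H) h u = (similarity_matrix cls r ^+ n *m c) i ord0.
Proof.
move=> hr hc; elim: n => [|n IHn] i u ui /=.
  by rewrite expr0 mul1mx (hc i).
by rewrite exprS -mulmxA; apply: neighbor_sum_class.
Qed.

End Classes.

Theorem theorem2p3 (H : graph) (k : nat) (cls : 'I_k -> {set H})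
  (r s : 'I_k -> H) (G0 : sgraph) (v0 : G0) (n : nat)
  (hcls : lists_classes cls)
  (hr : representatives cls r) (hs : representatives cls s) :
  num_colorings (pathlike v0 n) H =
    (size_row cls *m similarity_matrix cls r ^+ n *m hom_col s v0) ord0 ord0.
Proof.
(* The seed function is constant on classes, so its values can be read at [s] while the matrix is
   computed at [r]. *)
have hc i u : u \in cls i -> num_colorings_at v0 u = hom_col s v0 i ord0.
  move=> ui; rewrite mxE; apply: num_colorings_at_similar.
  exact: similar_in_class ui (hs i).
rewrite num_colorings_pathlike (sum_classes hcls) -mulmxA [RHS]mxE.
apply: eq_bigr => i _.
(* The summand is now constant on [cls i], so the inner sum contributes the factor [#|cls i|]. *)
rewrite (eq_bigr _ (iter_neighbor_sum_class hcls n hr hc (i := i))).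
by rewrite sum_nat_const [size_row _ _ _]mxE.
Qed.
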